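(* Let $F$ be a compact, totally disconnected subset of $\mathbb R$ with no isolated points. Then the lacunary metric $$d_\ell(x,y)=\sup\{|f(y)-f(x)|:\ f\in C(F),\ \|[D_\ell,f]\|\le1\}$$ coincides with the one induced by the metric on $\mathbb R$ if and only if $F$ has Lebesgue measure zero.
   Context: Let $[a,b]$ be the least closed interval containing $F$; $[a,b]\setminus F$ is the disjoint union of open intervals (lacunae) $I_n=(a_n,b_n)$, $n\ge1$. For a bounded interval $I$ let $\mathcal H(I)=\ell^2(\partial I)$ and $D(I)=\frac1{|I|}\begin{pmatrix}0&1\\1&0\end{pmatrix}$. Set $\mathcal H_\ell=\bigoplus_n\mathcal H(I_n)$ and $D_\ell=\bigoplus_nD(I_n)$. The algebra $C(F)$ of continuous functions on $F$ acts on $\mathcal H_\ell$ by multiplication, $(f\xi)(x)=f(x)\xi(x)$ for $x\in\{a_n,b_n:n\ge1\}$. With $\mathcal A=\mathrm{Lip}(F)$, the Lipschitz functions on $F$, $(\mathcal A,\mathcal H_\ell,D_\ell)$ is the lacunary spectral triple of $F$. One has $\|[D_\ell,f]\|=\sup_n\left|\frac{f(b_n)-f(a_n)}{b_n-a_n}\right|$.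
   Formalization: The supremum defining the lacunary metric is taken over Lipschitz functions f on F instead of all f in C(F); over C(F) the claim fails, e.g. for the ternary Cantor set, where multiples of the Cantor function commute with D_ℓ and make the distance from 0 to 1 infinite. *)

(* Defs.v *)
From HB Require Import structures.
From mathcomp Require Export all_boot all_order all_algebra.
From mathcomp Require Export complex.
From mathcomp Require Export all_classical all_reals all_analysis.

Set Implicit Arguments.
Unset Strict Implicit.
Unset Printing Implicit Defensive.

Import Order.TTheory GRing.Theory Num.Theory.
Import numFieldNormedType.Exports.

Local Open Scope classical_set_scope.
Local Open Scope ring_scope.

Section Lacunary.
Context {R : realType}.
Implicit Types (F : set R) (f : R -> R[i]).

Definition modulus (z : R[i]) : R := complex.Re `|z|.

Definition gaps F : set R := `[inf F, sup F]%classic `\` F.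

(* A lacuna ]u, v[ is encoded by the pair (u, v); the components of [gaps F]
   are automatically open intervals when [F] is closed and nonempty. *)
Definition lacunae F : set (R * R) :=
  [set I : R * R | I.1 < I.2 /\
    exists2 x, gaps F x & connected_component (gaps F) x = `]I.1, I.2[%classic].

Definition endpoint (I : R * R) (i : 'I_2) : R := if i == 0 then I.1 else I.2.

(* l^2 of the boundary of I, in the basis of the point masses at
   [endpoint I 0] and [endpoint I 1]. *)
Definition Dint (I : R * R) : 'M[R[i]]_2 :=
  ((I.2 - I.1)^-1)%:C%C *: \matrix_(i, j) (i != j)%:R.

(* All families of boundary vectors; the Hilbert space H_l is cut out by
   [ell2], and norms of general families are extended reals. *)
Definition bdfamily F : Type := lacunae F -> 'cV[R[i]]_2.

Definition fnorm F (xi : bdfamily F) : \bar R :=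
  sqrte (\esum_(I in [set: lacunae F]) (\sum_i modulus (xi I i 0) ^+ 2)%:E).

Definition ell2 F : set (bdfamily F) := [set xi | (fnorm xi < +oo)%E].

Definition Dl F (xi : bdfamily F) : bdfamily F := fun I => Dint (val I) *m xi I.

Definition domDl F : set (bdfamily F) := [set xi | ell2 xi /\ ell2 (Dl xi)].

Definition act F f (xi : bdfamily F) : bdfamily F :=
  fun I => \col_i (f (endpoint (val I) i) * xi I i 0).

(* Multiplication by a function bounded on [F] preserves [domDl F], so the
   commutator is an operator with domain [domDl F]. *)
Definition commDl F f (xi : bdfamily F) : bdfamily F :=
  fun I => Dl (act f xi) I - act f (Dl xi) I.

Definition commDl_norm F f : \bar R :=
  ereal_sup [set fnorm (commDl f xi) |
    xi in [set xi : bdfamily F | domDl xi /\ (fnorm xi <= 1)%E]].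

(* The algebra Lip(F) of the triple, its elements being represented by
   arbitrary extensions to the line: only values on [F] are ever used. *)
Definition lip F : set (R -> R[i]) :=
  [set f | exists k : R, forall x y, F x -> F y ->
    modulus (f x - f y) <= k * `|x - y|].

(* The distance is that of the triple (Lip(F), H_l, D_l), so the functions
   compete in Lip(F) and not in the whole of C(F).  The norm of the commutator
   only sees the increments of f across the lacunae, hence vanishes on the
   multiples of a Cantor function: over C(F) the supremum would be infinite
   for suitable points of every nonempty perfect totally disconnected F. *)
Definition lacunary_dist F (x y : R) : \bar R :=
  ereal_sup [set (modulus (f y - f x))%:E |
    f in [set f | lip F f /\ (commDl_norm F f <= 1)%E]].

End Lacunary.

(* Main.v *)
(** [commDl_norm F f <= 1] means that f is 1-Lipschitz across each lacuna.  If F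
    is null, cover it by an open set U of small measure: going from x to y, a
    k-Lipschitz f gains at most |y - x| over the lacunae and k |U| inside U.
    Conversely [t + |F `&` ]-oo, t]|] is Lipschitz and has increment exactly the
    length of I on every lacuna I, while from [inf F] to [sup F] it gains |F| in
    excess of the distance. *)
Require Import Defs.
From mathcomp Require Import ring lra.
Set Implicit Arguments.
Unset Strict Implicit.

Import Order.TTheory GRing.Theory Num.Theory.
Import numFieldNormedType.Exports.
Local Open Scope classical_set_scope.
Local Open Scope ring_scope.

(** * The real-valued modulus on [R[i]] *)

Section Modulus.
Context {R : realType}.
Implicit Types (z w : R[i]) (r : R).

Lemma modulusE z : (modulus z)%:C%C = `|z|.
Proof. by rewrite /modulus normc_def. Qed.

Lemma modulus_ge0 z : 0 <= modulus z.
Proof. by rewrite -lecR modulusE normr_ge0. Qed.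

Lemma modulusM z w : modulus (z * w) = modulus z * modulus w.
Proof. by apply: complexI; rewrite rmorphM /= !modulusE normrM. Qed.

Lemma le_modulusD z w : modulus (z + w) <= modulus z + modulus w.
Proof. by rewrite -lecR rmorphD /= !modulusE ler_normD. Qed.

Lemma modulusN z : modulus (- z) = modulus z.
Proof. by apply: complexI; rewrite !modulusE normrN. Qed.

Lemma modulus_real r : modulus r%:C%C = `|r|.
Proof. by rewrite /modulus normc_def /= expr0n addr0 sqrtr_sqr. Qed.

Lemma modulus0 : modulus (0 : R[i]) = 0.
Proof. by rewrite -[0](rmorph0 (real_complex R)) modulus_real normr0. Qed.

End Modulus.

(** * The commutator with the Dirac operator, lacuna by lacuna *)

Section CommutatorNorm.
Context {R : realType}.
Implicit Types (F : set R) (f : R -> R[i]) (I : R * R).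

Definition bdsqr (v : 'cV[R[i]]_2) : R := \sum_i modulus (v i 0) ^+ 2.

Lemma bdsqr_ge0 v : 0 <= bdsqr v.
Proof. by apply: sumr_ge0 => i _; rewrite exprn_ge0 ?modulus_ge0. Qed.

Lemma bdsqr0 : bdsqr 0 = 0.
Proof. by rewrite /bdsqr big1// => i _; rewrite mxE modulus0 expr0n. Qed.

Lemma le_fnorm F (xi eta : bdfamily F) :
  (forall J, bdsqr (xi J) <= bdsqr (eta J)) -> (fnorm xi <= fnorm eta)%E.
Proof.
move=> le_xi; rewrite lee_sqrt; last first.
  by apply: esum_ge0 => J _; rewrite lee_fin bdsqr_ge0.
by apply: le_esum => J _; rewrite lee_fin; exact: le_xi.
Qed.

Lemma fnorm_supp1 {F} (J : lacunae F) (xi : bdfamily F) :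
  (forall K, K != J -> xi K = 0) -> fnorm xi = sqrte (bdsqr (xi J))%:E.
Proof.
move=> xi0; rewrite /fnorm; congr sqrte.
rewrite -[RHS](@esum_set1 _ _ J (fun K => (bdsqr (xi K))%:E)); last first.
  by rewrite lee_fin bdsqr_ge0.
rewrite [RHS]esum_mkcond; apply: eq_esum => K _.
case: ifPn => // /negP KJ; rewrite xi0; first by congr EFin; exact: bdsqr0.
by apply/eqP => KJ'; apply: KJ; rewrite KJ' inE.
Qed.

Lemma Dint_mulE I (v : 'cV_2) i :
  (Dint I *m v) i 0 = ((I.2 - I.1)^-1)%:C%C * v (rev_ord i) 0.
Proof.
rewrite -scalemxAl !mxE !big_ord_recl big_ord0 !mxE.
by case: i => -[|[|//]] ?; rewrite /= ?mul0r ?mul1r ?addr0 ?add0r;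
  congr (_ * v _ _); apply: val_inj.
Qed.

(** [Dint] interchanges the two boundary points, so [f] is evaluated at opposite endpoints in the
    two products; [rev_ord] on ['I_2] is this interchange. *)
Lemma commDlE F f (xi : bdfamily F) (J : lacunae F) i :
  commDl f xi J i 0 = (((val J).2 - (val J).1)^-1)%:C%C *
    (f (endpoint (val J) (rev_ord i)) - f (endpoint (val J) i)) *
    xi J (rev_ord i) 0.
Proof.
have actE eta k : act f eta J k 0 = f (endpoint (val J) k) * eta J k 0.
  by rewrite mxE.
rewrite /commDl mxE [X in _ + X]mxE actE !Dint_mulE actE; ring.
Qed.

(** On one lacuna the commutator swaps the two coordinates and multiplies them by opposite
    difference quotients: it is an isometry up to a scalar. *)
Lemma bdsqr_commDl F f (xi : bdfamily F) (J : lacunae F) :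
  bdsqr (commDl f xi J) =
  (modulus (f (val J).2 - f (val J).1) / `|(val J).2 - (val J).1|) ^+ 2 *
  bdsqr (xi J).
Proof.
rewrite /bdsqr (reindex_inj rev_ord_inj) mulr_sumr; apply: eq_bigr => i _.
rewrite commDlE rev_ordK !modulusM modulus_real normfV.
rewrite exprMn; congr (_ ^+ 2 * _); rewrite mulrC; congr (_ * _).
case: i => -[|[|//]] ? ; rewrite /endpoint //=.
by rewrite -modulusN opprB.
Qed.

(** The commutator is block diagonal over the lacunae, so one direction tests it on a vector
    supported in a single block and the other compares norms block by block. *)
Lemma commDl_norm_le1 F f : (commDl_norm F f <= 1)%E <->
  forall I, lacunae F I -> modulus (f I.2 - f I.1) <= I.2 - I.1.
Proof.
split=> [le1 I lI|le_f].
  have I12 : I.1 < I.2 by case: lI.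
  pose J : lacunae F := SigSub (mem_set lI).
  (* The unit point mass at the left endpoint of [I]; with only one nonzero block it lies in the
     domain. *)
  pose xi : bdfamily F := fun K => if K == J then delta_mx 0 0 else 0.
  have xi0 K : K != J -> xi K = 0 by rewrite /xi => /negbTE ->.
  have xiJ : bdsqr (xi J) = 1.
    rewrite /bdsqr /xi eqxx !big_ord_recl big_ord0 !mxE /=.
    rewrite modulus0 -[1](rmorph1 (real_complex R)) modulus_real normr1.
    by rewrite expr0n expr1n !addr0.
  have fxi : fnorm xi = 1%E.
    by rewrite (fnorm_supp1 (J := J))// xiJ /= sqrtr1.
  have : (fnorm (commDl f xi) <= 1)%E.
    apply: le_trans le1; apply: ereal_sup_ubound; exists xi => //; split.
      split; first by rewrite /ell2 /= fxi ltry.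
      rewrite /ell2 /= (fnorm_supp1 (J := J)) ?ltry// => K /xi0 K0.
      by rewrite /Dl K0 mulmx0.
    by rewrite fxi.
  rewrite (fnorm_supp1 (J := J)); last first.
    move=> K /xi0 K0; apply/matrixP => i j.
    by rewrite ord1 commDlE K0 !mxE mulr0.
  rewrite bdsqr_commDl xiJ mulr1 /= lee_fin sqrtr_sqr.
  rewrite ger0_norm; last by rewrite mulr_ge0 ?invr_ge0 ?modulus_ge0.
  rewrite (gtr0_norm (_ : 0 < I.2 - I.1)) ?subr_gt0//.
  by rewrite ler_pdivrMr ?subr_gt0// mul1r.
apply: ge_ereal_sup => _ [xi [_ xi1]] <-; apply: le_trans xi1.
apply: le_fnorm => J; rewrite bdsqr_commDl ler_piMl ?bdsqr_ge0//.
have lJ : lacunae F (val J) by exact: set_valP.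
have J12 : (val J).1 < (val J).2 by case: lJ.
rewrite expr_le1 ?divr_ge0 ?modulus_ge0//.
rewrite (gtr0_norm (_ : 0 < _ - _)) ?subr_gt0// ler_pdivrMr ?subr_gt0//.
by rewrite mul1r le_f.
Qed.

End CommutatorNorm.

(** * The distribution function of Lebesgue measure restricted to a set of finite measure *)

Section Cumul.
Context {R : realType}.
Local Notation mu := (@lebesgue_measure R).
Variable A : set R.
Hypotheses (mA : measurable A) (fA : (mu A < +oo)%E).

Definition cumul (t : R) : R := fine (mu (A `&` `]-oo, t])).

Let mAI (i : interval R) : measurable (A `&` [set` i]).
Proof. by apply: measurableI => //; exact: measurable_itv. Qed.

Let fAI (i : interval R) : mu (A `&` [set` i]) \is a fin_num.
Proof.
rewrite ge0_fin_numE ?measure_ge0//; apply: le_lt_trans fA.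
by apply: le_measure; rewrite ?inE //; exact: mAI.
Qed.

Lemma cumulB s t : s <= t -> cumul t - cumul s = fine (mu (A `&` `]s, t])).
Proof.
move=> st; rewrite /cumul (@itv_bndbnd_setU _ _ -oo%O (BRight s) (BRight t))//.
rewrite setIUr measureU; [|exact: mAI|exact: mAI|].
  by rewrite fineD ?fAI// addrC addKr.
apply/seteqP; split=> // z [[_ /=]]; rewrite !in_itv /= => zs [_] /andP[].
by move=> /lt_le_trans /(_ zs); rewrite ltxx.
Qed.

Lemma cumul_homo s t : s <= t -> cumul s <= cumul t.
Proof. by move=> st; rewrite -subr_ge0 cumulB// fine_ge0. Qed.

Lemma cumulB_le s t : s <= t -> cumul t - cumul s <= t - s.
Proof.
move=> st; rewrite cumulB// -lee_fin fineK//.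
apply: (@le_trans _ _ (mu `]s, t])).
  apply: le_measure; last exact: subIsetr; rewrite inE; first exact: mAI.
  exact: measurable_itv.
rewrite lebesgue_measure_itv /= lte_fin; case: ifPn => // _.
by rewrite lee_fin subr_ge0.
Qed.

Lemma cumulB_le_total s t : s <= t -> cumul t - cumul s <= fine (mu A).
Proof.
move=> st; rewrite cumulB//; apply: fine_le => //.
  by rewrite ge0_fin_numE.
by apply: le_measure; rewrite ?inE //; exact: mAI.
Qed.

Lemma cumulB_sub s t : s <= t -> `]s, t] `<=` A -> cumul t - cumul s = t - s.
Proof.
move=> st stA; rewrite cumulB// setIidr// lebesgue_measure_itv /= lte_fin.
by move: st; rewrite le_eqVlt => /orP[/eqP ->|->]; rewrite ?ltxx ?subrr.
Qed.

End Cumul.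

(** * Lacunae as gaps between points of F, and growth estimates across them *)

Section Lacunae.
Context {R : realType}.
Implicit Types (F : set R) (s t : R).

Lemma closed_inf F : closed F -> F !=set0 -> has_lbound F -> F (inf F).
Proof.
move=> cF F0 lF; apply: contrapT => Fi.
have /nbhs_ballP[e /= e0 eF] : nbhs (inf F) (~` F).
  by apply: open_nbhs_nbhs; split; rewrite ?openC.
have [z Fz ze] := inf_adherent e0 (conj F0 lF).
apply: (eF z) => //; rewrite ball_itv /= in_itv /= ze andbT.
by rewrite ltrBlDr (le_lt_trans (ge_inf lF Fz))// ltrDl.
Qed.

(** The component of the midpoint in [gaps F] is an interval; if it left []s, t[] it would contain
    [s] or [t], which belong to F. *)
Lemma lacunae_gap F s t : has_lbound F -> has_ubound F -> s < t -> F s -> F t ->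
  (forall z, s < z < t -> ~ F z) -> lacunae F (s, t).
Proof.
move=> lF uF st Fs Ft stF; split=> //=.
have sub : `]s, t[ `<=` gaps F.
  move=> z /=; rewrite in_itv /= => stz; split; last exact: stF.
  rewrite /= in_itv /=; case/andP: stz => /ltW sz /ltW zt.
  rewrite (le_trans _ sz) ?ge_inf//= (le_trans zt)// ub_le_sup//.
have stm : s < (s + t) / 2 < t by rewrite !midf_lt.
have m_st : `]s, t[%classic ((s + t) / 2) by rewrite /= in_itv.
exists ((s + t) / 2); first exact: sub.
apply/seteqP; split; last first.
  apply: connected_component_max => //; apply/connected_intervalP.
  exact: interval_is_interval.
have /connected_intervalP ic := @component_connected _ (gaps F) ((s + t) / 2).
have cm : connected_component (gaps F) ((s + t) / 2) ((s + t) / 2).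
  by apply: connected_component_refl; exact: sub.
move=> z cz; rewrite /= in_itv /=; case/andP: stm => sm mt.
apply/andP; split; rewrite ltNge; apply/negP => zle.
  have : connected_component (gaps F) ((s + t) / 2) s.
    by apply: (ic _ _ cz cm); rewrite zle ltW.
  by move=> /connected_component_sub[].
have : connected_component (gaps F) ((s + t) / 2) t.
  by apply: (ic _ _ cm cz); rewrite zle ltW.
by move=> /connected_component_sub[].
Qed.

Lemma lacunae_disjoint F (I : R * R) z : lacunae F I -> I.1 < z < I.2 -> ~ F z.
Proof.
move=> [_ [x _ cI]] Iz; have : `]I.1, I.2[%classic z by rewrite /= in_itv.
by rewrite -cI => /connected_component_sub[].
Qed.

(* Continuous induction along F: the set of t for which the bound holds on
   [x, t] contains its supremum; past a point of it one advances either across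
   a gap of F or, by the growth of g, by a small step inside F. *)
Lemma gap_growth F (f : R -> R[i]) (g : R -> R) (k : R) :
  closed F -> 0 <= k -> {homo g : s t / s <= t} ->
  (forall s t, F s -> F t -> modulus (f s - f t) <= k * `|s - t|) ->
  (forall s t, s < t -> F s -> F t -> (forall z, s < z < t -> ~ F z) ->
     modulus (f t - f s) <= t - s) ->
  (forall s, F s -> exists2 e, 0 < e &
     forall t, s < t < s + e -> t - s <= g t - g s) ->
  forall x y, x <= y -> F x -> F y ->
    modulus (f y - f x) <= y - x + k * (g y - g x).
Proof.
move=> cF k0 g_homo f_lip f_gap g_loc x y xy Fx Fy.
have f_tri r s t :
    modulus (f t - f r) <= modulus (f t - f s) + modulus (f s - f r).
  by rewrite (le_trans _ (le_modulusD _ _))// addrA subrK.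
pose S := [set t | [/\ F t, x <= t <= y &
  modulus (f t - f x) <= t - x + k * (g t - g x)]].
have Sx : S x.
  by split=> //; rewrite ?lexx// !subrr mulr0 addr0 modulus0.
have S0 : S !=set0 by exists x.
have uS : has_ubound S by exists y => t [_ /andP[]].
pose s := sup S.
have leS t : S t -> t <= s by exact: ub_le_sup.
have Fs : F s.
  rewrite ((closure_id F).1 cF); apply: (@closureS _ S); first by move=> t [].
  exact: closure_sup.
have sy : s <= y by apply: ge_sup => // t [_ /andP[]].
have xs : x <= s by exact: leS.
have Ss : S s.
  (* The bound passes to the supremum by the Lipschitz estimate: some [t] in S satisfies
     [s - t < e / (k + 1)], so going on to [s] costs at most [e]. Adding 1 keeps the denominator
     positive when [k = 0]. *)
  split; [by []|by rewrite xs|apply/ler_addgt0Pr => e e0].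
  have k1 : 0 < k + 1 by rewrite ltr_wpDl.
  have [t St st] : exists2 t, S t & s - e / (k + 1) < t.
    by apply: sup_adherent; rewrite ?divr_gt0.
  have ts := leS _ St; case: St => Ft _ ft.
  have := f_lip _ _ Fs Ft; rewrite ger0_norm ?subr_ge0// => fst.
  have gst : k * g t <= k * g s by rewrite ler_wpM2l ?g_homo.
  have ste : (k + 1) * (s - t) <= e.
    by rewrite mulrC -ler_pdivlMr// ltW// ltrBlDr -ltrBlDl.
  have := f_tri x t s; move: ft; lra.
have step t : S t -> ~ s < t by move=> /leS ts; apply/negP; rewrite -leNgt.
suff -> : y = s by case: Ss.
apply/eqP; rewrite eq_le sy andbT leNgt; apply/negP => lt_sy.
have [_ _ fs] := Ss.
have [e e0 ge] := g_loc _ Fs.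
(* If F has a point of []s, y]] within [e] of [s], the growth of [g] pays for the Lipschitz step to
   it; otherwise a gap of F starts at [s]. *)
have [[t [Ft st te ty]]|none] :=
    pselect (exists t, [/\ F t, s < t, t < s + e & t <= y]).
  apply: (step t) => //; split=> //; first by rewrite (le_trans xs (ltW st)).
  have := f_lip _ _ Ft Fs; rewrite gtr0_norm ?subr_gt0// => fst.
  have : k * (t - s) <= k * (g t - g s) by rewrite ler_wpM2l// ge// st.
  have := f_tri x s t; move: fst fs; lra.
(* T contains every point of F beyond [s]; starting it at [s + e] makes it closed, so its infimum is
   attained and is the right end of the gap. *)
pose T := F `&` `[s + e, +oo[.
have T_of z : F z -> s < z -> T z.
  move=> Fz sz; split=> //; rewrite /= in_itv /= andbT leNgt; apply/negP => ze.
  apply: none; have [zy|yz] := leP z y; first by exists z.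
  by exists y; split=> //; exact: lt_trans ze.
have Ty : T y by exact: T_of.
have lT : has_lbound T by exists (s + e) => z [_ /=]; rewrite in_itv andbT.
have [Ft] : T (inf T).
  apply: closed_inf => //; last by exists y.
  by apply: closedI => //; exact: interval_closed.
rewrite /= in_itv /= andbT => set_; set t := inf T in Ft set_.
have st : s < t by rewrite (lt_le_trans _ set_)// ltrDl.
have ty : t <= y by exact: ge_inf.
apply: (step t) => //; split=> //; first by rewrite (le_trans xs (ltW st)).
have fst : modulus (f t - f s) <= t - s.
  apply: f_gap => // z /andP[sz zt] Fz.
  have : t <= z by apply: ge_inf => //; exact: T_of.
  by rewrite leNgt zt.
have gst : k * g s <= k * g t by rewrite ler_wpM2l ?g_homo// ltW.
have := f_tri x s t; move: fst fs; lra.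
Qed.

End Lacunae.

(** * Comparison of the lacunary distance with the Euclidean one *)

Section LacunaryDistance.
Context {R : realType}.
Local Notation mu := (@lebesgue_measure R).
Variable F : set R.
Hypothesis compactF : compact F.

Let closedF : closed F.
Proof. exact: compact_closed (@norm_hausdorff _ _) compactF. Qed.

Let measurableF : measurable F.
Proof. exact: measurable_realfun.compact_measurable. Qed.

Let boundF : exists M : R, forall x, F x -> `|x| <= M.
Proof.
have [M [_ HM]] := compact_bounded compactF.
by exists (M + 1) => x Fx; apply: HM; rewrite ?ltrDl.
Qed.

Let lbF : has_lbound F.
Proof.
by have [M HM] := boundF; exists (- M) => x /HM; rewrite ler_norml => /andP[].
Qed.

Let ubF : has_ubound F.
Proof.
by have [M HM] := boundF; exists M => x /HM; rewrite ler_norml => /andP[].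
Qed.

Lemma lacunary_distC x y : lacunary_dist F x y = lacunary_dist F y x.
Proof.
congr ereal_sup; apply/seteqP.
by split=> _ [f ? <-]; exists f => //; rewrite -modulusN opprB.
Qed.

(** The identity function competes: all its difference quotients equal 1. *)
Lemma lacunary_dist_ge x y : (`|x - y|%:E <= lacunary_dist F x y)%E.
Proof.
apply: ereal_sup_ubound; exists (fun t => t%:C%C); last first.
  by rewrite -rmorphB modulus_real distrC.
split; first by exists 1 => s t _ _; rewrite -rmorphB modulus_real mul1r.
apply/commDl_norm_le1 => I [I12 _].
by rewrite -rmorphB modulus_real gtr0_norm ?subr_gt0.
Qed.

Lemma lacunary_dist_le x y : mu F = 0%E -> F x -> F y ->
  (lacunary_dist F x y <= `|x - y|%:E)%E.
Proof.
move=> F0; wlog xy : x y / x <= y => [wlog_xy|] Fx Fy.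
  case: (leP x y) => [|/ltW] ?; first exact: wlog_xy.
  by rewrite lacunary_distC distrC wlog_xy.
apply: ge_ereal_sup => _ [f [[k0 f_lip] /commDl_norm_le1 f_le] <-].
rewrite lee_fin distrC (ger0_norm (_ : 0 <= y - x)) ?subr_ge0//.
(* The constant [k0] may be negative, for instance when F has at most one point, whereas
   [gap_growth] asks for a nonnegative one. *)
pose k := `|k0|; have k1 : 0 < k + 1 by rewrite ltr_wpDl ?normr_ge0.
apply/ler_addgt0Pr => e e0.
have [U [openU FU mU]] : exists U, [/\ open U, F `<=` U &
    (mu (U `\` F) < (e / (k + 1))%:E)%E].
  apply: lebesgue_regularity_outer; first exact: measurableF.
    by rewrite [ltLHS]F0 ltry.
  by rewrite divr_gt0.
have measurableU : measurable U by exact: measurable_realfun.open_measurable.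
have muU : mu U = mu (U `\` F).
  rewrite -[in LHS](setUIDK U F) setIidr// setUC measureU0//.
  exact: measurableD.
have finU : (mu U < +oo)%E by rewrite muU (lt_trans mU)// ltry.
have fin_e : fine (mu U) <= e / (k + 1).
  rewrite -lee_fin fineK ?ge0_fin_numE ?measure_ge0//.
  by rewrite muU ltW.
(* [cumul U] serves as the growth function: U is open around each point of F, so there it increases
   with slope 1, while its total increase is at most the measure of U. *)
apply: (@le_trans _ _ (y - x + k * (cumul U y - cumul U x))).
  apply: (@gap_growth _ F) => //.
  - exact: normr_ge0.
  - by move=> s t; exact: cumul_homo.
  - move=> s t Fs Ft; apply: le_trans (f_lip _ _ Fs Ft) _.
    by rewrite ler_wpM2r// ler_norm.
  - by move=> s t st Fs Ft stF; apply: (f_le (s, t)); exact: lacunae_gap.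
  - move=> s /FU Us; have /nbhs_ballP[d /= d0 dU] : nbhs s U.
      exact: open_nbhs_nbhs.
    exists d => // t /andP[st td]; rewrite (cumulB_sub measurableU finU (ltW st))// => z.
    rewrite /= in_itv /= => /andP[sz zt]; apply: dU.
    rewrite ball_itv /= in_itv /= (le_lt_trans zt td) andbT.
    by rewrite (lt_trans _ sz)// ltrBlDr ltrDl.
rewrite lerD2l; have := le_trans (cumulB_le_total measurableU finU xy) fin_e.
rewrite ler_pdivlMr// => le_e.
have : cumul U x <= cumul U y by exact: cumul_homo.
move: le_e; lra.
Qed.

Lemma lacunary_dist_eq_measure0 :
  (forall x y, F x -> F y -> lacunary_dist F x y = `|x - y|%:E) -> mu F = 0%E.
Proof.
(* The empty set is treated apart, since [inf F] and [sup F] must belong to F below. *)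
move=> dF; have [->|/set0P F0] := eqVneq F set0; first exact: measure0.
have finF : (mu F < +oo)%E by exact: compact_finite_measure.
have Finf : F (inf F) by exact: closed_inf.
have Fsup : F (sup F).
  by rewrite [X in X _]((closure_id F).1 closedF); exact: closure_sup.
have inf_sup : inf F <= sup F by exact: ge_inf.
(* Both summands are nondecreasing and 1-Lipschitz, whence the Lipschitz constant 2. *)
pose h t := t + cumul F t.
have hB s t : s <= t -> t - s <= h t - h s <= 2 * (t - s).
  move=> st; have := cumulB_le measurableF finF st.
  have := cumul_homo measurableF finF st; rewrite /h; lra.
have h_le : ((modulus ((h (sup F))%:C%C - (h (inf F))%:C%C))%:E <=
    `|inf F - sup F|%:E)%E.
  rewrite -(dF _ _ Finf Fsup); apply: ereal_sup_ubound.
  exists (fun t => (h t)%:C%C) => //; split.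
    exists 2 => s t _ _; rewrite -rmorphB modulus_real.
    wlog st : s t / s <= t => [wlog_st|].
      case: (leP s t) => [|/ltW] ?; first exact: wlog_st.
      by rewrite distrC [`|s - t|]distrC wlog_st.
    have := hB _ _ st.
    rewrite distrC [`|s - t|]distrC => /andP[le1 le2].
    by rewrite !ger0_norm ?subr_ge0// -subr_ge0 (le_trans _ le1)// subr_ge0.
  apply/commDl_norm_le1 => I lI; have I12 : I.1 < I.2 by case: lI.
  (* F meets []I.1, I.2]] at most in the point [I.2]. *)
  have cI : cumul F I.2 - cumul F I.1 = 0.
    rewrite cumulB// ?ltW// (_ : mu _ = 0%E)//.
    apply: (@subset_measure0 _ _ _ mu _ [set I.2]) => //.
    - by apply: measurableI => //; exact: measurable_itv.
    - move=> z [Fz]; rewrite /= in_itv /= => /andP[Iz].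
      rewrite le_eqVlt => /orP[/eqP//|zI].
      by exfalso; apply: (lacunae_disjoint lI _ Fz); rewrite Iz.
    - exact: lebesgue_measure_set1.
  rewrite -rmorphB modulus_real (_ : h I.2 - h I.1 = I.2 - I.1).
    by rewrite gtr0_norm ?subr_gt0.
  by rewrite /h; move: cI; lra.
move: h_le; rewrite lee_fin -rmorphB modulus_real distrC [leRHS]distrC.
have /andP[h_ge _] := hB _ _ inf_sup.
rewrite distrC (ger0_norm (_ : 0 <= sup F - inf F)) ?subr_ge0//.
rewrite ger0_norm; last by rewrite (le_trans _ h_ge)// subr_ge0.
(* The assumed equality of distances leaves [h] no room beyond the increment of the identity. *)
move=> h_le; have c0 : cumul F (sup F) - cumul F (inf F) = 0.
  have := cumul_homo measurableF finF inf_sup.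
  by move: h_le; rewrite /h; lra.
have mFI : measurable (F `&` `]inf F, sup F]).
  by apply: measurableI => //; exact: measurable_itv.
(* The increment of [cumul F] misses only the left endpoint, a null set. *)
have FE : F = (F `&` `]inf F, sup F]) `|` [set inf F].
  apply/seteqP; split=> [z Fz|z [[]//|-> //]].
  have iz : inf F <= z by exact: ge_inf.
  have zs : z <= sup F by exact: ub_le_sup.
  move: iz; rewrite le_eqVlt => /orP[/eqP <-|iz]; first by right.
  by left; split=> //; rewrite /= in_itv /= iz.
rewrite FE measureU0//; last exact: lebesgue_measure_set1.
move: c0; rewrite cumulB// => c0.
rewrite -[LHS]fineK ?c0// ge0_fin_numE ?measure_ge0//.
by apply: le_lt_trans finF; apply: le_measure; rewrite ?inE.
Qed.

End LacunaryDistance.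

Theorem theorem4p4 (R : realType) (F : set R) :
  compact F -> totally_disconnected F -> isolated F = set0 ->
  (forall x y : R, F x -> F y -> lacunary_dist F x y = `|x - y|%:E) <->
  lebesgue_measure F = 0%E.
Proof.
move=> cF _ _; split; first exact: lacunary_dist_eq_measure0.
move=> F0 x y Fx Fy; apply/eqP; rewrite eq_le lacunary_dist_le//=.
exact: lacunary_dist_ge.
Qed.
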